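(* (a) Let $\bar z\in\mathbb R^n$ be a local minimizer of (P). Then, for each $\lambda\in K(\bar z)$, the point $(\bar z,\lambda)$ is a local minimizer of (Q). (b) Let $\bar z\in\operatorname{dom}K$ be such that $(\bar z,\lambda)\in\mathbb R^n\times\mathbb R^m$ is a local minimizer of (Q) for each $\lambda\in K(\bar z)$. Furthermore, let $K$ be inner semicompact at $\bar z$ w.r.t. $\operatorname{dom} K$. Then $\bar z$ is a local minimizer of (P).
   Context: Let $f\colon\mathbb R^n\to\mathbb R$ be locally Lipschitz continuous, let $F\colon\mathbb R^n\rightrightarrows\mathbb R^m$ and $G\colon\mathbb R^n\times\mathbb R^m\rightrightarrows\mathbb R^s$ be set-valued mappings with closed graphs, and let $M\subset\mathbb R^n$ be nonempty and closed. Set $H(z):=\bigcup_{\lambda\in F(z)}G(z,\lambda)$. Problem (P): minimize $f(z)$ over $z\in\mathbb R^n$ subject to $0\in H(z)$, $z\in M$. Problem (Q): minimize $f(z)$ over $(z,\lambda)\in\mathbb R^n\times\mathbb R^m$ subject to $\lambda\in F(z)$, $0\in G(z,\lambda)$, $z\in M$ (local minimality is w.r.t. neighborhoods in $\mathbb R^n\times\mathbb R^m$). The intermediate mapping $K\colon\mathbb R^n\rightrightarrows\mathbb R^m$ is $K(z):=\{\lambda\in F(z)\mid 0\in G(z,\lambda)\}$. For a set-valued mapping $\Upsilon\colon\mathbb R^n\rightrightarrows\mathbb R^m$, $\operatorname{dom}\Upsilon:=\{z\mid\Upsilon(z)\ne\varnothing\}$. $\Upsilon$ is inner semicompact at $\bar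 z\in\operatorname{dom}\Upsilon$ w.r.t. $\Omega\subset\mathbb R^n$ if for each sequence $\{z_k\}\subset\Omega$ with $z_k\to\bar z$ there are a subsequence $\{z_{k_l}\}_{l\in\mathbb N}$ and a convergent sequence $\{w_l\}_{l\in\mathbb N}\subset\mathbb R^m$ with $w_l\in\Upsilon(z_{k_l})$ for all $l\in\mathbb N$. *)

(* Defs.v *)
From HB Require Import structures.
From mathcomp Require Import all_boot all_order all_algebra.
From mathcomp Require Import all_classical all_reals all_analysis.
Import Order.TTheory GRing.Theory Num.Theory.
Import numFieldNormedType.Exports.

Set Implicit Arguments.
Unset Strict Implicit.
Unset Printing Implicit Defensive.

Local Open Scope classical_set_scope.
Local Open Scope ring_scope.

(* A set-valued mapping from S to T is a function S -> set T.  The space R^n is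
   'rV[R]_n, which carries the maximum norm; every notion below depends only on
   the topology, or is invariant under a change of equivalent norms. *)

Definition dom (S T : Type) (Y : S -> set T) : set S := [set z | Y z !=set0].

Definition gph (S T : Type) (Y : S -> set T) : set (S * T) :=
  [set p | Y p.1 p.2].

Definition locally_lipschitz (R : realType) (n : nat) (f : 'rV[R]_n -> R) :=
  forall x : 'rV[R]_n, exists2 U : set 'rV[R]_n, nbhs x U & [lipschitz f u | u in U].

Definition local_minimizer (R : realType) (T : topologicalType)
    (f : T -> R) (A : set T) (x : T) :=
  A x /\ \forall y \near x, A y -> f x <= f y.

(* [increasing_seq] means strictly increasing. *)
Definition inner_semicompact (R : realType) (n m : nat)
    (Y : 'rV[R]_n -> set 'rV[R]_m) (zbar : 'rV[R]_n) (Omega : set 'rV[R]_n) :=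
  dom Y zbar /\
  forall z : nat -> 'rV[R]_n,
    (forall k, Omega (z k)) -> z @ \oo --> zbar ->
    exists (k : nat -> nat) (w : nat -> 'rV[R]_m),
      [/\ increasing_seq k, cvgn w & forall l, Y (z (k l)) (w l)].

Section problems.
Variables (R : realType) (n m s : nat).
Variables (f : 'rV[R]_n -> R) (F : 'rV[R]_n -> set 'rV[R]_m).
Variables (G : 'rV[R]_n * 'rV[R]_m -> set 'rV[R]_s) (M : set 'rV[R]_n).

Definition H_map (z : 'rV[R]_n) : set 'rV[R]_s :=
  \bigcup_(lambda in F z) G (z, lambda).

Definition K_map (z : 'rV[R]_n) : set 'rV[R]_m :=
  [set lambda | F z lambda /\ G (z, lambda) 0].

Definition feasP : set 'rV[R]_n := [set z | H_map z 0 /\ M z].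

Definition feasQ : set ('rV[R]_n * 'rV[R]_m) :=
  [set p | [/\ F p.1 p.2, G p 0 & M p.1]].

Definition local_minimizerP (z : 'rV[R]_n) := local_minimizer f feasP z.

Definition local_minimizerQ (p : 'rV[R]_n * 'rV[R]_m) :=
  local_minimizer (fun q : 'rV[R]_n * 'rV[R]_m => f q.1) feasQ p.

End problems.

(* Main.v *)
(* For (b), were zbar not a local minimizer of (P), feasible points z_k -> zbar
   with f (z_k) < f zbar would exist.  They lie in dom K, so inner semicompactness
   yields multipliers w_l in K (z_(k_l)) converging to some w.  Closedness of the
   graph of K gives w \in K zbar, and the points (z_(k_l), w_l) -> (zbar, w)
   contradict the local minimality of (zbar, w) for (Q). *)

Require Import Defs.
From HB Require Import structures.
From mathcomp Require Import all_boot all_order all_algebra.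
From mathcomp Require Import all_classical all_reals all_analysis.
Import Order.TTheory GRing.Theory Num.Theory.
Import numFieldNormedType.Exports.

Local Open Scope classical_set_scope.
Local Open Scope ring_scope.

(** Each ball of radius [1/(k+1)] around [x] contains a point violating [P], since otherwise that
    ball would witness the neighborhood statement; choosing one such point for every [k] gives the
    sequence. *)
Lemma not_near_cvg_seq (R : realType) (T : pseudoMetricType R) (x : T)
    (P : T -> Prop) :
  ~ (\forall y \near x, P y) ->
  exists2 u : nat -> T, u @ \oo --> x & forall k, ~ P (u k).
Proof.
move=> nP.
have /choice[u uP] (k : nat) : exists y, ball x (k.+1%:R^-1 : R) y /\ ~ P y.
  apply: contrapT => /forallNP nE; apply: nP.
  apply/nbhs_ballP; exists (k.+1%:R^-1 : R); first by rewrite /= invr_gt0.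
  by move=> y xy; apply: contrapT => nPy; apply: (nE y).
exists u; last by move=> k; case: (uP k).
apply/cvg_ballP => e e0; near=> k.
have [xu _] := uP k; apply: le_ball xu.
by apply: ltW; near: k; exact: near_infty_natSinv_lt (PosNum e0).
Unshelve. all: by end_near. Qed.

(** A strictly increasing sequence of naturals satisfies [l <= k l]. *)
Lemma increasing_seq_cvgn (k : nat -> nat) : increasing_seq k -> k @ \oo --> \oo.
Proof.
move=> kinc A [N _ NA].
have ge_id l : (l <= k l)%N.
  elim: l => // l IHl; apply: leq_ltn_trans IHl _.
  by move/increasing_seqP: kinc => /(_ l); rewrite ltEnat.
by exists N => // l /= Nl; apply: NA => /=; exact: leq_trans Nl (ge_id l).
Qed.

Lemma K_map_feasQ (R : realType) (n m s : nat)
    (F : 'rV[R]_n -> set 'rV[R]_m)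
    (G : 'rV[R]_n * 'rV[R]_m -> set 'rV[R]_s) (M : set 'rV[R]_n) z lambda :
  feasQ F G M (z, lambda) <-> K_map F G z lambda /\ M z.
Proof. by split=> [[]|[[]]]. Qed.

Lemma feasP_dom_K_map (R : realType) (n m s : nat)
    (F : 'rV[R]_n -> set 'rV[R]_m)
    (G : 'rV[R]_n * 'rV[R]_m -> set 'rV[R]_s) (M : set 'rV[R]_n) z :
  feasP F G M z <-> dom (K_map F G) z /\ M z.
Proof.
by split=> [[[l Fl Gl] Mz]|[[l [Fl Gl]] Mz]]; split=> //; exists l.
Qed.

(** The condition [0 \in G p] is the preimage of [gph G] under the continuous map sending [p] to
    [(p, 0)], so the graph of [K_map F G] is an intersection of two closed sets. *)
Lemma closed_gph_K_map (R : realType) (n m s : nat)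
    (F : 'rV[R]_n -> set 'rV[R]_m)
    (G : 'rV[R]_n * 'rV[R]_m -> set 'rV[R]_s) :
  closed (gph F) -> closed (gph G) -> closed (gph (K_map F G)).
Proof.
move=> hF hG.
have -> : gph (K_map F G) =
    gph F `&` (fun p : 'rV[R]_n * 'rV[R]_m => (p, 0 : 'rV[R]_s)) @^-1` gph G.
  by apply/seteqP; split=> -[].
apply: closedI => //; apply: closed_comp => // p _.
exact: (cvg_pair (G := nbhs p) (H := nbhs (0 : 'rV[R]_s)) cvg_id (cvg_cst _)).
Qed.

Theorem theorem4p5 (R : realType) (n m s : nat)
    (f : 'rV[R]_n -> R) (F : 'rV[R]_n -> set 'rV[R]_m)
    (G : 'rV[R]_n * 'rV[R]_m -> set 'rV[R]_s) (M : set 'rV[R]_n)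
    (hf : locally_lipschitz f)
    (hF : closed (gph F)) (hG : closed (gph G))
    (hM0 : M !=set0) (hM : closed M) :
  (forall zbar : 'rV[R]_n, local_minimizerP f F G M zbar ->
     forall lambda : 'rV[R]_m, K_map F G zbar lambda ->
       local_minimizerQ f F G M (zbar, lambda))
  /\
  (forall zbar : 'rV[R]_n, dom (K_map F G) zbar ->
     (forall lambda : 'rV[R]_m, K_map F G zbar lambda ->
        local_minimizerQ f F G M (zbar, lambda)) ->
     inner_semicompact (K_map F G) zbar (dom (K_map F G)) ->
     local_minimizerP f F G M zbar).
Proof.
split=> [z [/feasP_dom_K_map[_ Mz] zmin] l Kl|z [l0 Kl0] Qmin [_ Ksc]].
  split; first exact/K_map_feasQ.
  (* The neighborhood of [z] lifts to a cylinder around [(z, l)], by continuity of the first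
     projection. *)
  have : \forall p \near (z, l), feasP F G M p.1 -> f z <= f p.1.
    exact: (@cvg_fst _ _ (nbhs z) (nbhs l) _ _ zmin).
  apply: filterS => -[y k] /= ymin /K_map_feasQ[Kyk My]; apply: ymin.
  by apply/feasP_dom_K_map; split=> //; exists k.
split.
  (* Membership of [z] in [dom (K_map F G)] says nothing about [M]; feasibility of [(z, l0)] for (Q)
     supplies [M z]. *)
  have [/K_map_feasQ[_ Mz] _] := Qmin _ Kl0.
  by apply/feasP_dom_K_map; split=> //; exists l0.
apply: contrapT => /not_near_cvg_seq[u uz nu].
have uP k : feasP F G M (u k) /\ ~ f z <= f (u k) by exact/not_implyP/nu.
have uK k : dom (K_map F G) (u k) by case: (uP k) => /feasP_dom_K_map[].
have [k [w [kinc wcvg Kw]]] := Ksc u uK uz.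
have uwcvg : (u (k l), w l) @[l --> \oo] --> (z, limn w).
  have ukz : u (k l) @[l --> \oo] --> z.
    exact: cvg_comp (increasing_seq_cvgn _ kinc) uz.
  exact: (cvg_pair (G := nbhs z) (H := nbhs (limn w)) ukz wcvg).
have Kz : gph (K_map F G) (z, limn w).
  apply: (closed_cvg _ (closed_gph_K_map _ _ _ _ _ _ hF hG) _ _ uwcvg).
  exact: nearW.
have [_ Qnear] := Qmin _ Kz.
(* Local minimality at [(z, limn w)] holds along the tail of the sequence, and a single index [l] of
   that tail is enough for the contradiction. *)
have /filter_ex[l /= fl] : \forall l \near \oo,
    feasQ F G M (u (k l), w l) -> f z <= f (u (k l)) := uwcvg _ Qnear.
have [/feasP_dom_K_map[_ Mu] nfu] := uP (k l).
by apply/nfu/fl/K_map_feasQ.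
Qed.
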